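(* Let $n\ge1$ and let $\Sigma\subset\mathbb R^{n+1}$ be a closed set which is parabolic ADR with constant $M$ and which satisfies the (two-sided) corkscrew condition with constant $\gamma_0\in(0,1)$. Assume in addition that $\Sigma$ is parabolic uniformly rectifiable with constants $(M,\tilde M)$. Then $\Sigma$ satisfies the weak time-synchronized two cube condition with a constant $\gamma_1\in(0,1)$ depending only on $n,M,\gamma_0,\tilde M$.
   Context: Points of $\mathbb R^{n+1}$ are written $(X,t)$, $X\in\mathbb R^n$, $t\in\mathbb R$. Parabolic distance: $d_p((X,t),(Y,s))=|X-Y|+|t-s|^{1/2}$; diameters and distances are measured in this metric. Parabolic cube: $Q_r(X,t)=\{(Y,s): |y_i-x_i|<r,\ i=1,\dots,n,\ |t-s|<r^2\}$. $\mathcal H^{n+1}_p$ is the $(n+1)$-dimensional Hausdorff measure built with $d_p$-diameters; for closed $\Sigma$, $\sigma=\mathcal H^{n+1}_p$ restricted to $\Sigma$, $\Delta(X,t,r)=\Sigma\cap Q_r(X,t)$, $T_0$ and $T_1$ are the infimum and supremum of time coordinates of points of $\Sigma$. Parabolic ADR with constant $M$: $M^{-1}r^{n+1}\le\sigma(\Delta(X,t,r))\le Mr^{n+1}$ for $(X,t)\in\Sigma$, $T_0<t<T_1$, $0<r<\operatorname{diam}\Sigma$. Parabolic uniform rectifiability with constants $(M,\tilde M)$: $\Sigma$ is parabolic ADR with constant $M$ and, setting $\beta(Z,\tau,r)=\inf_P\big(r^{-n-1}\iint_{\Delta(Z,\tau,r)}(d_p((Y,s),P)/r)^2\,d\sigma(Y,s)\big)^{1/2}$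 (infimum over $n$-dimensional planes $P$ containing a line parallel to the $t$-axis) and $d\nu(Z,\tau,r)=\beta^2(Z,\tau,r)\,d\sigma(Z,\tau)\,r^{-1}dr$, one has $\sup_{(X,t)\in\Sigma,\rho>0}\rho^{-n-1}\nu(\Delta(X,t,\rho)\times(0,\rho))\le\tilde M$. Corkscrew condition with constant $\gamma_0\in(0,1)$: for all $(X,t)\in\Sigma$ with $T_0<t<T_1$ and $0<r<\operatorname{diam}\Sigma$ there are parabolic cubes $Q_\rho(X_1,t_1),Q_\rho(X_2,t_2)\subset Q_r(X,t)$ with $\gamma_0r\le\rho<r$ such that $Q_\rho(X_i,t_i)\cap(\mathbb R^n\times(T_0,T_1))$, $i=1,2$, lie in different connected components of $\mathbb R^{n+1}\setminus\Sigma$. Weak time-synchronized two cube condition with constant $\gamma_1$: the same with $\gamma_1$ in place of $\gamma_0$ and additionally $t_1=t_2$. *)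

(* Defs.v *)
From HB Require Import structures.
From mathcomp Require Import all_boot all_order all_algebra.
From mathcomp Require Import all_classical all_reals all_analysis.
Set Implicit Arguments. Unset Strict Implicit. Unset Printing Implicit Defensive.
Import Order.TTheory GRing.Theory Num.Theory.
Import numFieldNormedType.Exports.
Local Open Scope classical_set_scope.
Local Open Scope ring_scope.

(* points (X,t) of R^{n+1} = R^n x R *)
Notation pt R n := ('rV[R]_n * R)%type.

Notation borelT R n := (g_sigma_algebraType (@open (pt R n))).

Section Parabolic.
Variables (R : realType) (n : nat).
Local Notation pt := (pt R n).
Local Notation borelT := (borelT R n).


Definition eucl (X : 'rV[R]_n) : R := Num.sqrt (\sum_i (X 0 i) ^+ 2).

Definition dp (p q : pt) : R := eucl (p.1 - q.1) + Num.sqrt `|p.2 - q.2|.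

Definition cube (r : R) (p : pt) : set pt :=
  [set q : pt | (forall i, `|q.1 0 i - p.1 0 i| < r) /\ `|p.2 - q.2| < r ^+ 2].

(* parabolic diameter (in \bar R; -oo for the empty set) *)
Definition diamp (E : set pt) : \bar R :=
  ereal_sup [set (dp x.1 x.2)%:E | x in E `*` E].

Definition Hdelta (s : nat) (delta : R) (A : set pt) : \bar R :=
  ereal_inf [set (\sum_(0 <= j <oo) ((fine (diamp (E j))) ^+ s)%:E)%E
            | E in [set E : nat -> set pt |
                    A `<=` \bigcup_j E j /\ forall j, (diamp (E j) < delta%:E)%E]].

Definition Hp (s : nat) (A : set pt) : \bar R :=
  ereal_sup [set Hdelta s delta A | delta in [set delta : R | 0 < delta]].

Definition T0 (S : set pt) : \bar R := ereal_inf [set p.2%:E | p in S].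
Definition T1 (S : set pt) : \bar R := ereal_sup [set p.2%:E | p in S].

Definition slab (S : set pt) : set pt :=
  [set p : pt | (T0 S < p.2%:E)%E /\ (p.2%:E < T1 S)%E].

(* n-dimensional planes containing a line parallel to the t-axis *)
Definition vplane (u : 'rV[R]_n) (c : R) : set pt :=
  [set p : pt | \sum_i u 0 i * p.1 0 i = c].
Definition is_vplane (P : set pt) : Prop :=
  exists u c, u != 0 /\ P = vplane u c.

Definition distp (p : pt) (P : set pt) : R := inf [set dp p q | q in P].

Variable mu : {measure set borelT -> \bar R}.
Variable S : set pt.

Definition Delta (p : pt) (r : R) : set pt := S `&` cube r p.

Definition beta (z : pt) (r : R) : \bar R :=
  ereal_inf [set sqrte ((r ^- n.+1)%:E *
                 \int[mu]_(y in (Delta z r : set borelT))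
                    (((distp y P) / r) ^+ 2)%:E)%E
            | P in is_vplane].

Definition open0 (rho : R) : set R := `]0, rho[%classic.

Definition nu_box (p : pt) (rho : R) : \bar R :=
  (\int[mu]_(z in (Delta p rho : set borelT))
     \int[lebesgue_measure]_(r in open0 rho)
        (beta z r * beta z r * (r^-1)%:E))%E.

Definition pADR (M : R) : Prop :=
  forall p : pt, S p -> (T0 S < p.2%:E)%E -> (p.2%:E < T1 S)%E ->
  forall r : R, 0 < r -> (r%:E < diamp S)%E ->
    ((M^-1 * r ^+ n.+1)%:E <= mu (Delta p r : set borelT))%E /\
    (mu (Delta p r : set borelT) <= (M * r ^+ n.+1)%:E)%E.

Definition pUR (M Mt : R) : Prop :=
  pADR M /\
  forall p : pt, S p -> forall rho : R, 0 < rho ->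
    (nu_box p rho <= (Mt * rho ^+ n.+1)%:E)%E.

End Parabolic.

Section Corkscrew.
Variables (R : realType) (n : nat) (S : set (pt R n)).

Definition diff_components (A B : set (pt R n)) : Prop :=
  exists x1 x2 : pt R n, ~ S x1 /\ ~ S x2 /\
    A `<=` connected_component (~` S) x1 /\
    B `<=` connected_component (~` S) x2 /\
    ~ connected_component (~` S) x1 x2.

Definition corkscrew (g : R) : Prop :=
  forall p : pt R n, S p -> (T0 S < p.2%:E)%E -> (p.2%:E < T1 S)%E ->
  forall r : R, 0 < r -> (r%:E < diamp S)%E ->
  exists (rho : R) (p1 p2 : pt R n),
    g * r <= rho /\ rho < r /\
    cube rho p1 `<=` cube r p /\ cube rho p2 `<=` cube r p /\
    diff_components (cube rho p1 `&` slab S) (cube rho p2 `&` slab S).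

Definition weak_ts_two_cube (g : R) : Prop :=
  forall p : pt R n, S p -> (T0 S < p.2%:E)%E -> (p.2%:E < T1 S)%E ->
  forall r : R, 0 < r -> (r%:E < diamp S)%E ->
  exists (rho : R) (p1 p2 : pt R n),
    g * r <= rho /\ rho < r /\
    cube rho p1 `<=` cube r p /\ cube rho p2 `<=` cube r p /\
    p1.2 = p2.2 /\
    diff_components (cube rho p1 `&` slab S) (cube rho p2 `&` slab S).

End Corkscrew.

(* Main.v *)
Require Import Defs.
From HB Require Import structures.
From mathcomp Require Import all_boot all_order all_algebra.
From mathcomp Require Import all_classical all_reals all_analysis.
From mathcomp Require Import measurable_realfun ring lra.
Import Order.TTheory GRing.Theory Num.Theory.
Import numFieldNormedType.Exports.
Local Open Scope classical_set_scope.
Local Open Scope ring_scope.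

(** The Carleson bound forbids [beta] from being bounded below at all scales
    between [rho / 2^K] and [rho], so some cube of comparable size centred on the
    set has [beta] below a prescribed threshold; by ADR, inside the half-size
    cube the set lies in a thin neighbourhood of a vertical plane.  Each of the
    two corkscrew cubes taken there contains a smaller cube on one side of the
    neighbourhood; that side of the half-size cube is convex and misses the
    set, so the smaller cube can be moved to the time of the centre without
    leaving its component.  ADR and the vanishing of the measure of
    time slices provide a starting point far from the extreme times [T0] and
    [T1], so that no cube meets the boundary of the slab. *)

Set Implicit Arguments. Unset Strict Implicit. Unset Printing Implicit Defensive.

(** * Lower bounds for integrals of nonnegative functions *)

(* No measurability is assumed here, as [beta] is not known to be measurable:
   the integral of a nonnegative function is a supremum over the simple
   functions below it. *)
Lemma ge0_le_lower_integral d (T : measurableType d) (R : realType)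
    (mu : {measure set T -> \bar R}) (D : set T) (f g : T -> \bar R) :
  (forall x, D x -> (0 <= g x)%E) -> (forall x, D x -> (g x <= f x)%E) ->
  (\int[mu]_(x in D) g x <= \int[mu]_(x in D) f x)%E.
Proof.
move=> g0 gf.
have f0 x : D x -> (0 <= f x)%E by move=> Dx; apply: le_trans (g0 x Dx) (gf x Dx).
rewrite !ge0_integralE//; apply: le_ereal_sup => _ /= [h hg <-]; exists h => // x.
apply: le_trans (hg x) _; rewrite !patchE; case: ifPn => // /set_mem; exact: gf.
Qed.

(** Extending [g] by zero outside [A] turns both sides into integrals over [D]. *)
Lemma ge0_le_integral_sub d (T : measurableType d) (R : realType)
    (mu : {measure set T -> \bar R}) (A D : set T) (f g : T -> \bar R) :
  A `<=` D -> (forall x, D x -> (0 <= f x)%E) ->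
  (forall x, A x -> (0 <= g x)%E) -> (forall x, A x -> (g x <= f x)%E) ->
  (\int[mu]_(x in A) g x <= \int[mu]_(x in D) f x)%E.
Proof.
move=> AD f0 g0 gf.
have -> : (\int[mu]_(x in A) g x = \int[mu]_(x in D) (g \_ A) x)%E.
  rewrite integral_mkcond [RHS]integral_mkcond; congr (integral _ _ _).
  apply/funext => x; rewrite !patchE; case: ifPn => [/set_mem Ax|//].
    by rewrite (mem_set (AD _ Ax)).
  by case: ifP.
apply: ge0_le_lower_integral => x Dx; rewrite patchE; case: ifPn => [/set_mem Ax|_].
- exact: g0.
- by [].
- exact: gf.
- exact: f0.
Qed.

Lemma ge0_integral_ge_cst d (T : measurableType d) (R : realType)
    (mu : {measure set T -> \bar R}) (A D : set T) (f : T -> \bar R) (c : \bar R) :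
  measurable A -> A `<=` D -> (0 <= c)%E -> (forall x, D x -> (0 <= f x)%E) ->
  (forall x, A x -> (c <= f x)%E) ->
  (c * mu A <= \int[mu]_(x in D) f x)%E.
Proof.
move=> mA AD c0 f0 cf; rewrite -integral_cst//; exact: ge0_le_integral_sub.
Qed.

(** The dyadic intervals are disjoint, and on the [k]-th one [r < rho / 2 ^+ k] gives
    [2 ^+ k / rho < 1 / r]. The left side is a step function standing in for [e / r]. *)
Lemma dyadic_minorant (R : realType) (rho e r : R) (K : nat) :
  0 < rho -> 0 <= e ->
  \sum_(k < K) e * 2 ^+ k / rho * \1_(`]rho / 2 ^+ k.+1, rho / 2 ^+ k[%classic : set R) r <=
  if (rho / 2 ^+ K < r) && (r < rho) then e / r else 0.
Proof.
move=> rho0 e0; elim: K => [|K IH].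
  by rewrite big_ord0; case: ifP => // /andP[]; rewrite expr0 divr1 => /lt_trans h/h; rewrite ltxx.
have h2 : 0 < 2 ^+ K :> R by rewrite exprn_gt0.
have hlt : rho / 2 ^+ K.+1 < rho / 2 ^+ K.
  by rewrite ltr_pM2l// ltf_pV2 ?posrE ?exprn_gt0// exprS ltr_pMl// ltr1n.
(* Above [rho / 2 ^+ K] the new interval misses [r]; otherwise the induction hypothesis bounds the
   earlier terms by [0]. *)
rewrite big_ord_recr/= indicE; case: (ltP (rho / 2 ^+ K) r) IH => [h|h]/= IH.
  rewrite memNset; last by rewrite /= in_itv/= => /andP[_ /lt_trans/(_ h)]; rewrite ltxx.
  by rewrite mulr0 addr0 (lt_trans hlt h).
apply: (@le_trans _ _ (0 + e * 2 ^+ K / rho *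
    (r \in (`]rho / 2 ^+ K.+1, rho / 2 ^+ K[%classic : set R))%:R)).
  by rewrite lerD2r.
rewrite add0r; have [/set_mem|_] := boolP (r \in _); last first.
  rewrite mulr0; case: ifP => // /andP[h1 _]; rewrite divr_ge0// ltW// (le_lt_trans _ h1)//.
  by rewrite divr_ge0// ?ltW// exprn_ge0.
rewrite /= in_itv/= => /andP[h1 h3]; rewrite h1/=.
have r0 : 0 < r by rewrite (le_lt_trans _ h1)// divr_ge0// ?ltW// exprn_gt0.
have -> : r < rho.
  by rewrite (lt_le_trans h3)// ler_pdivrMr ?exprn_gt0// ler_peMr ?(ltW rho0)// exprn_ege1// ler1n.
rewrite mulr1 -mulrA; apply: ler_wpM2l => //.
by rewrite ler_pdivrMr// ler_pdivlMl// -ler_pdivlMr// ltW.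
Qed.

(** Each of the [K] dyadic intervals contributes [e * 2 ^+ k / rho] times its length
    [rho / 2 ^+ k.+1], that is [e / 2]. *)
Lemma ge0_integral_log (R : realType) (rho e : R) (K : nat) (f : R -> \bar R) :
  0 < rho -> 0 <= e -> (forall r, 0 < r < rho -> (0 <= f r)%E) ->
  (forall r, rho / 2 ^+ K < r < rho -> ((e / r)%:E <= f r)%E) ->
  ((K%:R * e / 2)%:E <= \int[lebesgue_measure]_(r in `]0%R, rho[%classic) f r)%E.
Proof.
move=> rho0 e0 f0 fe.
pose I k : set R := `]rho / 2 ^+ k.+1, rho / 2 ^+ k[%classic.
pose c (k : nat) := e * 2 ^+ k / rho.
have c0 k : 0 <= c k by rewrite /c divr_ge0// ?mulr_ge0// ?ltW// exprn_ge0.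
pose g (r : R) := (\sum_(k < K) (c k)%:E * (\1_(I k) r)%:E)%E.
have gE r : g r = (\sum_(k < K) c k * \1_(I k) r)%:E.
  by rewrite /g -sumEFin.
apply: (@le_trans _ _ (\int[lebesgue_measure]_(r in `]0%R, rho[%classic) g r)%E); last first.
  apply: ge0_le_lower_integral => r /=; rewrite in_itv/= => /andP[r0 rr]; rewrite gE.
    by rewrite lee_fin; apply: sumr_ge0 => k _; rewrite mulr_ge0.
  apply: (@le_trans _ _ (if (rho / 2 ^+ K < r) && (r < rho) then e / r else 0)%:E).
    by rewrite lee_fin; exact: dyadic_minorant.
  by case: ifP => h; [exact: fe | apply: f0; rewrite r0].
rewrite /g ge0_integral_sum//; last 2 first.
- move=> k; apply: measurable_funeM; apply: measurableT_comp; first by [].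
  by apply: measurable_indic; exact: measurable_itv.
- by move=> k r _; rewrite mule_ge0// lee_fin.
rewrite (_ : \sum_(k < K) _ = (\sum_(k < K) (e / 2)%:E)%E).
  by rewrite sumEFin lee_fin sumr_const card_ord -[leRHS]mulr_natl mulrA.
apply: eq_bigr => k _.
rewrite ge0_integralZl//; last 2 first.
- by apply: measurableT_comp; [by []|apply: measurable_indic; exact: measurable_itv].
- by rewrite lee_fin.
rewrite integral_indic//; last exact: measurable_itv.
have h2 : 0 < 2 ^+ k :> R by rewrite exprn_gt0.
have hlt : rho / 2 ^+ k.+1 < rho / 2 ^+ k.
  by rewrite ltr_pM2l// ltf_pV2 ?posrE ?exprn_gt0// exprS ltr_pMl// ltr1n.
have -> : I k `&` `]0%R, rho[ = I k.
  apply/setIidPl => r; rewrite /I/= !in_itv/= => /andP[h1 h3]; apply/andP; split.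
    by rewrite (le_lt_trans _ h1)// divr_ge0// ?ltW// exprn_gt0.
  by rewrite (lt_le_trans h3)// ler_pdivrMr ?exprn_gt0// ler_peMr ?(ltW rho0)// exprn_ege1// ler1n.
have mI : lebesgue_measure (I k) = (rho / 2 ^+ k - rho / 2 ^+ k.+1)%:E.
  by apply: etrans (lebesgue_measure_itv _) _; rewrite /= lte_fin hlt EFinB.
apply: etrans (congr1 (mule _) mI) _; rewrite -EFinM; congr (_%:E).
rewrite /c exprS; field; by rewrite !gt_eqF.
Qed.

(** * Parabolic cubes, Borel sets and connectedness along segments *)

Section Geometry.
Variables (R : realType) (n : nat).
Implicit Types (p q y z : pt R n) (X Y u : 'rV[R]_n) (r s a : R).

Lemma ler_coord_eucl X i : `|X 0 i| <= eucl X.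
Proof.
rewrite -sqrtr_sqr /eucl ler_sqrt ?sumr_ge0// => [|j _]; last exact: sqr_ge0.
by rewrite (bigD1 i)//= lerDl sumr_ge0// => j _; exact: sqr_ge0.
Qed.

Lemma eucl_le X r : 0 <= r -> (forall i, `|X 0 i| <= r) -> eucl X <= n%:R * r.
Proof.
move=> r0 Xr; rewrite -[leRHS]ger0_norm ?mulr_ge0// -sqrtr_sqr /eucl ler_sqrt ?sqr_ge0//.
apply: (@le_trans _ _ (\sum_(i < n) r ^+ 2)).
  by apply: ler_sum => i _; rewrite -[X in X <= _]real_normK ?num_real// lerXn2r ?nnegrE.
rewrite sumr_const card_ord -[leLHS]mulr_natl exprMn ler_wpM2r ?sqr_ge0// -natrX ler_nat.
by case: n => // m; rewrite leq_pmulr.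
Qed.

Lemma dp_ge0 p q : 0 <= dp p q.
Proof. by rewrite addr_ge0// sqrtr_ge0. Qed.

Lemma cube_center r p : 0 < r -> cube r p p.
Proof. by move=> r0; split=> [i|]; rewrite subrr normr0 ?exprn_gt0. Qed.

(** Radii add although times scale quadratically, because [s ^+ 2 + r ^+ 2 <= (s + r) ^+ 2]. *)
Lemma cube_sub s r a p q : 0 <= s -> 0 <= r -> cube s p q -> s + r <= a ->
  cube r q `<=` cube a p.
Proof.
move=> s0 r0 [sX st] sra y [rX rt]; split=> [i|].
  move: (sX i) (rX i); rewrite !ltr_norml => /andP[? ?] /andP[? ?]; lra.
have : (s + r) ^+ 2 <= a ^+ 2 by rewrite lerXn2r ?nnegrE// ?addr_ge0// (le_trans _ sra)// addr_ge0.
have : s ^+ 2 + r ^+ 2 <= (s + r) ^+ 2 by have := mulr_ge0 s0 r0; nra.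
move: st rt; rewrite !ltr_norml => /andP[? ?] /andP[? ?]; lra.
Qed.

Lemma open_cube r p : open (cube r p).
Proof.
have -> : cube r p = (\big[setI/setT]_(i < n) [set q : pt R n | `|q.1 0 i - p.1 0 i| < r]) `&`
    [set q : pt R n | `|p.2 - q.2| < r ^+ 2].
  rewrite -bigcap_seq; apply/seteqP; split=> q /= [h1 h2]; split=> //.
  - by move=> i _; exact: h1.
  - by move=> i; apply: h1; exact: mem_index_enum.
apply: openI.
  apply: (big_ind (fun A : set (pt R n) => open A)).
  - exact: openT.
  - exact: openI.
  move=> i _.
  have -> : [set q : pt R n | `|q.1 0 i - p.1 0 i| < r] =
    (fun q : pt R n => `|q.1 0 i - p.1 0 i|) @^-1` [set t | t < r] by [].
  apply: open_comp; last exact: open_lt.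
  move=> q _; apply: cvg_norm; apply: cvgB; last exact: cvg_cst.
  apply: (@continuous_comp _ _ _ (@fst _ _) (fun M : 'rV[R]_n => M 0 i)); first exact: cvg_fst.
  exact: coord_continuous.
have -> : [set q : pt R n | `|p.2 - q.2| < r ^+ 2] =
    (fun q : pt R n => `|p.2 - q.2|) @^-1` [set t | t < r ^+ 2] by [].
apply: open_comp; last exact: open_lt.
move=> q _; apply: cvg_norm; apply: cvgB; first exact: cvg_cst.
exact: cvg_snd.
Qed.

Lemma closed_time a : closed [set q : pt R n | q.2 = a].
Proof.
have -> : [set q : pt R n | q.2 = a] = @snd _ _ @^-1` [set a] by [].
apply: closed_comp; last exact: closed_eq.
by move=> q _; exact: cvg_snd.
Qed.

Lemma open_measurable (A : set (borelT R n)) : open (A : set (pt R n)) -> measurable A.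
Proof. exact: sub_sigma_algebra. Qed.

Lemma closed_measurable (A : set (borelT R n)) : closed (A : set (pt R n)) -> measurable A.
Proof.
by move=> cA; rewrite -(setCK A); apply: measurableC; apply: open_measurable; exact: closed_openC.
Qed.

Definition seg p q : R -> pt R n := fun t => (p.1 + t *: (q.1 - p.1), p.2 + t * (q.2 - p.2)).

Lemma seg_continuous p q : continuous (seg p q).
Proof.
move=> t.
have h1 : p.1 + x *: (q.1 - p.1) @[x --> t] --> p.1 + t *: (q.1 - p.1).
  apply: cvgD; first exact: cvg_cst.
  by apply: cvgZr_tmp; exact: cvg_id.
have h2 : p.2 + x * (q.2 - p.2) @[x --> t] --> p.2 + t * (q.2 - p.2).
  by apply: cvgD; [exact: cvg_cst | apply: cvgM; [exact: cvg_id | exact: cvg_cst]].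
exact: cvg_pair h1 h2.
Qed.

(** The image of [[0, 1]] under [seg p q] is a connected subset of [U] joining [p] to [q]. *)
Lemma seg_component (U : set (pt R n)) p q x :
  (forall t, 0 <= t <= 1 -> U (seg p q t)) -> connected_component U x p ->
  connected_component U x q.
Proof.
move=> Useg xp; apply: connected_component_trans xp _.
have seg0 : seg p q 0 = p by rewrite /seg scale0r mul0r !addr0; case: (p).
have seg1 : seg p q 1 = q.
  by rewrite /seg scale1r mul1r !(addrC p.1, addrC p.2) !subrK; case: (q).
have cseg : connected (seg p q @` `[0, 1]).
  apply: connected_continuous_connected; first exact: segment_connected.
  by apply: continuous_subspaceT; exact: seg_continuous.
apply: (@connected_component_max _ U (seg p q @` `[0, 1])) => //.
- by exists 0; [rewrite /= in_itv/= lexx ler01|].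
- by move=> _ [t /= + <-]; rewrite in_itv/=; exact: Useg.
- by exists 1; [rewrite /= in_itv/= lexx ler01|].
Qed.

End Geometry.

(** * Vertical planes as zero sets of affine functions *)

Section Affine.
Variables (R : realType) (n : nat).
Implicit Types (p q y z : pt R n) (X Y u : 'rV[R]_n) (r s t c : R).

Definition l1norm u : R := \sum_i `|u 0 i|.

(* With the l1 normalisation [aff] is 1-Lipschitz for the sup norm, whose
   balls are the spatial parts of the cubes. *)
Definition aff u c X : R := (\sum_i u 0 i * X 0 i - c) / l1norm u.

(** Direction of sup norm at most one whose pairing with [u] is [l1norm u], so that [aff] grows
    along it at unit rate. *)
Definition sgrow u : 'rV[R]_n := \row_i Num.sg (u 0 i).

Lemma l1norm_gt0 u : u != 0 -> 0 < l1norm u.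
Proof.
move=> u0; rewrite lt0r sumr_ge0// andbT; apply: contra_neq u0 => /eqP.
rewrite psumr_eq0// => /allP h; apply/rowP => i; rewrite mxE.
by apply/eqP; rewrite -normr_eq0; apply: h; rewrite mem_index_enum.
Qed.

Lemma aff_lip u c X Y r : u != 0 -> (forall i, `|X 0 i - Y 0 i| <= r) ->
  `|aff u c X - aff u c Y| <= r.
Proof.
move=> /l1norm_gt0 u0 XY.
have -> : aff u c X - aff u c Y = (\sum_i u 0 i * (X 0 i - Y 0 i)) / l1norm u.
  rewrite /aff -mulrBl; congr (_ / _).
  under [in RHS]eq_bigr do rewrite mulrBr.
  by rewrite big_split/= sumrN; lra.
rewrite normrM normfV (gtr0_norm u0) ler_pdivrMr//.
apply: le_trans (ler_norm_sum _ _ _) _; rewrite mulr_sumr.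
by apply: ler_sum => i _; rewrite normrM mulrC ler_wpM2r.
Qed.

Lemma aff_shift u c X t : u != 0 -> aff u c (X + t *: sgrow u) = aff u c X + t.
Proof.
move=> /l1norm_gt0 u0; rewrite /aff.
have -> : \sum_i u 0 i * (X + t *: sgrow u) 0 i = \sum_i u 0 i * X 0 i + t * l1norm u.
  rewrite mulr_sumr -big_split/=; apply: eq_bigr => i _.
  by rewrite !mxE mulrDr (normrEsg (u 0 i)); ring.
by field; rewrite gt_eqF.
Qed.

Lemma aff_segment u c X Y t :
  aff u c (X + t *: (Y - X)) = (1 - t) * aff u c X + t * aff u c Y.
Proof.
rewrite /aff !mulrA -mulrDl; congr (_ / _).
have -> : \sum_i u 0 i * (X + t *: (Y - X)) 0 i =
    (1 - t) * (\sum_i u 0 i * X 0 i) + t * (\sum_i u 0 i * Y 0 i).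
  by rewrite !mulr_sumr -big_split/=; apply: eq_bigr => i _; rewrite !mxE; ring.
by ring.
Qed.

(** [aff u c] vanishes on the plane and coordinate differences are at most [dp], so [aff_lip]
    applies. *)
Lemma aff_le_distp u c p : u != 0 -> `|aff u c p.1| <= distp p (vplane u c).
Proof.
move=> u0; have l0 := l1norm_gt0 u0; apply: lb_le_inf.
  (* The plane must be shown nonempty: moving the origin along [sgrow u] until [aff] vanishes gives
     a point of it. *)
  pose w : pt R n := ((- aff u c 0) *: sgrow u, 0).
  exists (dp p w), w => //; rewrite /vplane/=.
  have := aff_shift c 0 (- aff u c 0) u0; rewrite add0r subrr => /eqP.
  by rewrite /aff mulf_eq0 invr_eq0 (gt_eqF l0) orbF subr_eq0 => /eqP.
move=> _ [q /= qP <-].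
have -> : aff u c p.1 = aff u c p.1 - aff u c q.1.
  by rewrite {3}/aff qP subrr mul0r subr0.
apply: aff_lip => // i; have := ler_coord_eucl (p.1 - q.1) i.
by rewrite !mxE => /le_trans; apply; rewrite /dp lerDl sqrtr_ge0.
Qed.

End Affine.

(** * Grid coverings and the null measure of time slices *)

Section Grid.
Variables (R : realType) (n : nat).
Implicit Types (p q y z : pt R n) (X Y P : 'rV[R]_n) (r s t a : R).

(** Cell index when the spatial cube of centre [P] and radius [r] is cut into [m.+1] pieces per
    axis. Inside that cube the truncation is below [m.+1], so [inord] is harmless. *)
Definition grid m P r X : {ffun 'I_n -> 'I_m.+1} :=
  [ffun i => inord (Num.trunc ((X 0 i - P 0 i + r) * (m.+1%:R / (2 * r))))].

Lemma grid_close m P r X Y : 0 < r ->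
  (forall i, `|X 0 i - P 0 i| < r) -> (forall i, `|Y 0 i - P 0 i| < r) ->
  grid m P r X = grid m P r Y -> forall i, `|X 0 i - Y 0 i| < 2 * r / m.+1%:R.
Proof.
move=> r0 XP YP XY i; have := congr1 (fun f : {ffun 'I_n -> 'I_m.+1} => nat_of_ord (f i)) XY.
rewrite !ffunE; have k0 : 0 < m.+1%:R / (2 * r) by rewrite divr_gt0// mulr_gt0.
set k := m.+1%:R / (2 * r) in k0 *.
have kr : k * (2 * r) = m.+1%:R by rewrite /k mulfVK// gt_eqF// mulr_gt0.
have bnd (Z : 'rV[R]_n) : `|Z 0 i - P 0 i| < r ->
  0 <= (Z 0 i - P 0 i + r) * k /\ (Num.trunc ((Z 0 i - P 0 i + r) * k)%R < m.+1)%N.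
  rewrite ltr_norml => /andP[h1 h2]; have h : 0 <= (Z 0 i - P 0 i + r) * k.
    by rewrite mulr_ge0// ?(ltW k0)//; lra.
  by split=> //; rewrite truncn_lt_nat// -kr mulrC ltr_pM2l//; lra.
have [x0 xm] := bnd X (XP i); have [y0 ym] := bnd Y (YP i).
rewrite !inordK// => e; have := truncn_itv x0; have := truncn_itv y0; rewrite -e.
set T := (Num.trunc _)%:R; rewrite -natr1 -/T => /andP[a1 a2] /andP[b1 b2].
rewrite ltr_pdivlMr ?ltr0n// -kr mulrA gtr_pMl ?mulr_gt0//.
have : -1 < (X 0 i - Y 0 i) * k < 1 by apply/andP; split; lra.
by rewrite -ltr_norml normrM (gtr0_norm k0).
Qed.

Lemma diamp_le (E : set (pt R n)) D :
  (forall x y, E x -> E y -> dp x y <= D) -> (diamp E <= D%:E)%E.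
Proof.
by move=> h; apply: ge_ereal_sup => _ [x [/= h1 h2] <-]; rewrite lee_fin; exact: h.
Qed.

(** The empty set has diameter [-oo], which [fine] sends to [0]; as the exponent is positive, it
    costs nothing in a covering sum. *)
Lemma fine_diamp_pow (E : set (pt R n)) D k : 0 <= D -> (diamp E <= D%:E)%E ->
  0 <= fine (diamp E) ^+ k.+1 <= D ^+ k.+1.
Proof.
move=> D0 h; have [->|/set0P[x Ex]] := eqVneq E set0.
  rewrite /diamp (_ : [set _ | _ in _] = set0); last by apply/seteqP; split=> // _ [y [[]]].
  by rewrite ereal_sup0/= expr0n/= lexx exprn_ge0.
have d0 : (0 <= diamp E)%E.
  apply: (@le_trans _ _ (dp x x)%:E); first by rewrite lee_fin dp_ge0.
  by apply: ereal_sup_ubound; exists (x, x).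
have f0 : 0 <= fine (diamp E) by exact: fine_ge0.
rewrite exprn_ge0// lerXn2r ?nnegrE// -lee_fin fineK//.
by rewrite ge0_fin_numE// (le_lt_trans h)// ltry.
Qed.

(* N^n grid cells of diameter O(1/N) contribute O(1/N) to the measure. *)
Lemma Hp_time_slice (A : set (pt R n)) p r a : 0 < r ->
  A `<=` cube r p `&` [set q | q.2 = a] -> (Hp n.+1 A <= 0)%E.
Proof.
move=> r0 AE; apply: ge_ereal_sup => _ [d /= d0 <-].
apply/lee_addgt0Pr => e e0; rewrite add0e.
(* [B / m.+1%:R] bounds the diameter of a cell. In the choice of [m], the first summand puts this
   below [d] and the second makes the covering sum at most [e]. *)
pose B := 2 * r * n%:R; have B0 : 0 <= B by rewrite !mulr_ge0// ltW.
pose m := Num.trunc (B / d + B ^+ n.+1 / e).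
have := truncnS_gt (B / d + B ^+ n.+1 / e); rewrite -/m => mB.
have m0 : 0 < m.+1%:R :> R by rewrite ltr0n.
have Bd : 0 <= B / d by rewrite divr_ge0// ltW.
have Be : 0 <= B ^+ n.+1 / e by rewrite divr_ge0// ?exprn_ge0// ltW.
pose D := B / m.+1%:R; have D0 : 0 <= D by rewrite divr_ge0// ltW.
have Dd : D < d by rewrite /D ltr_pdivrMr// mulrC -ltr_pdivrMr//; lra.
pose K := #|{: {ffun 'I_n -> 'I_m.+1}}|.
have KD : K%:R * D ^+ n.+1 <= e.
  rewrite /K card_ffun !card_ord natrX /D expr_div_n exprS (exprS m.+1%:R) -/B.
  rewrite (_ : _ * _ = B ^+ n.+1 / m.+1%:R); last first.
    by rewrite exprS; field; rewrite ?expf_neq0 ?gt_eqF.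
  by rewrite ler_pdivrMr// mulrC -ler_pdivrMr//; lra.
(* The cells are listed by rank; every index from [K] on gives the empty set, so the series is a
   finite sum. *)
pose E (j : nat) : set (pt R n) := [set q | A q /\ enum_rank (grid m p.1 r q.1) = j :> nat].
have dE j : (diamp (E j) <= D%:E)%E.
  apply: diamp_le => x y [/AE[[xc _] /= xa] xj] [/AE[[yc _] /= ya] yj].
  rewrite /dp xa ya subrr normr0 sqrtr0 addr0 /D /B mulrAC mulrC; apply: eucl_le.
    by rewrite divr_ge0// ?mulr_ge0 ?ltW.
  move=> i; rewrite !mxE; apply/ltW/(@grid_close m p.1) => //.
  by apply/enum_rank_inj/val_inj; rewrite /= xj yj.
have fE j := fine_diamp_pow n D0 (dE j).
apply: (@le_trans _ _ (\sum_(0 <= j <oo) ((fine (diamp (E j))) ^+ n.+1)%:E)%E).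
  apply: ereal_inf_lbound; exists E => //; split=> [q Aq|j].
    by exists (enum_rank (grid m p.1 r q.1) : nat).
  by apply: le_lt_trans (dE j) _; rewrite lte_fin.
rewrite (nneseries_split 0 K); last by move=> j _; rewrite lee_fin; case/andP: (fE j).
rewrite add0n eseries0 ?adde0; last first.
  move=> j Kj _; rewrite (_ : E j = set0); last first.
    apply/seteqP; split=> // q [_ h]; move: Kj; rewrite -h leqNgt => /negP; apply.
    exact: ltn_ord.
  rewrite /diamp (_ : [set _ | _ in _] = set0); last by apply/seteqP; split=> // _ [y [[]]].
  by rewrite ereal_sup0/= expr0n.
rewrite sumEFin lee_fin; apply: le_trans KD.
apply: (@le_trans _ _ (\sum_(0 <= j < K) D ^+ n.+1)).
  by apply: ler_sum => j _; case/andP: (fE j).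
by rewrite sumr_const_nat subn0 mulr_natl.
Qed.

End Grid.

(** * Extreme times, flat scales and synchronized cubes *)

Section TwoCube.
Variables (R : realType) (n : nat) (S : set (pt R n)).
Variables (mu : {measure set (borelT R n) -> \bar R}) (M : R).
Implicit Types (p q y z : pt R n) (X Y u : 'rV[R]_n) (r s d c : R).

Lemma cube_convex r z p q t : cube r z p -> cube r z q -> 0 <= t <= 1 ->
  cube r z (seg p q t).
Proof.
have conv (a b c e : R) : `|a - c| < e -> `|b - c| < e -> 0 <= t <= 1 ->
    `|a + t * (b - a) - c| < e.
  move=> ae be /andP[t0 t1]; pose m := Num.max `|a - c| `|b - c|.
  have : `|a - c| <= m /\ `|b - c| <= m by rewrite !le_max !lexx orbT.
  have me : m < e by rewrite gt_max ae be.
  rewrite !ler_norml => -[/andP[a1 a2] /andP[b1 b2]]; apply: le_lt_trans me.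
  by rewrite ler_norml; apply/andP; split; nra.
move=> [pX pt] [qX qt] t01; split=> [i|] /=.
  by rewrite !mxE; exact: conv.
by rewrite distrC; apply: conv => //; rewrite distrC.
Qed.

Lemma measurable_Delta p r : closed S -> measurable (Delta S p r : set (borelT R n)).
Proof.
move=> cS; apply: measurableI; first exact: closed_measurable.
by apply: open_measurable; exact: open_cube.
Qed.

Lemma bigsetU_le (I : finType) (F : I -> set (borelT R n)) (e : \bar R) :
  (forall i, measurable (F i)) -> (forall i, (mu (F i) <= e)%E) ->
  (mu (\big[setU/set0]_i F i) <= \sum_(i : I) e)%E.
Proof.
move=> mF Fe.
suff [] : measurable (\big[setU/set0]_i F i) /\
    (mu (\big[setU/set0]_i F i) <= \sum_(i : I) e)%E by [].
apply: (big_ind2 (fun (A : set (borelT R n)) (x : \bar R) => measurable A /\ (mu A <= x)%E)).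
- by rewrite measure0.
- move=> A x B y [mA Ax] [mB By]; split; first exact: measurableU.
  by apply: le_trans (measureU2 _ mA mB) _; exact: leeD.
- by move=> i _; split.
Qed.

Lemma time_bounds q : S q -> (T0 S <= q.2%:E)%E /\ (q.2%:E <= T1 S)%E.
Proof.
by move=> Sq; split; [apply: ereal_inf_lbound|apply: ereal_sup_ubound]; exists q.
Qed.

(** [q.2] lies between the extreme times, so one of them, necessarily finite, lies weakly between
    [y.2] and [q.2]. The boolean [b] tells which. *)
Lemma not_slab_near q y h : S q -> cube h q y -> ~ slab S y ->
  exists b : bool, `|q.2 - fine (if b then T1 S else T0 S)| < h ^+ 2.
Proof.
move=> /time_bounds[q0 q1] [_ qy] /not_andP[] /negP; rewrite -leNgt => hy.
- exists false; case: (T0 S) q0 hy => [a||]//; rewrite !lee_fin => ? ?.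
  by move: qy; rewrite /= !ltr_norml => /andP[? ?]; apply/andP; split; lra.
- exists true; case: (T1 S) q1 hy => [a||]//; rewrite !lee_fin => ? ?.
  by move: qy; rewrite /= !ltr_norml => /andP[? ?]; apply/andP; split; lra.
Qed.

Lemma not_slab_time q : S q -> ~ slab S q ->
  exists b : bool, q.2 = fine (if b then T1 S else T0 S).
Proof.
move=> /time_bounds[q0 q1] /not_andP[] /negP; rewrite -leNgt => hq.
- by exists false; case: (T0 S) q0 hq => [a||]//; rewrite !lee_fin/=; lra.
- by exists true; case: (T1 S) q1 hq => [a||]//; rewrite !lee_fin/=; lra.
Qed.

Hypothesis M0 : 0 < M.
Hypothesis cS : closed S.
Hypothesis muHp : forall A : set (borelT R n), measurable A -> mu A = Hp n.+1 (A `&` S).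
Hypothesis adr : pADR mu S M.

Lemma mu_time_slice p r a : 0 < r ->
  measurable (cube r p `&` [set q | q.2 = a] : set (borelT R n)) /\
  mu (cube r p `&` [set q | q.2 = a]) = 0%E.
Proof.
move=> r0; have mA : measurable (cube r p `&` [set q | q.2 = a] : set (borelT R n)).
  apply: measurableI; first by apply: open_measurable; exact: open_cube.
  by apply: closed_measurable; exact: closed_time.
split=> //; apply/eqP; rewrite eq_le measure_ge0 andbT muHp//.
by apply: (@Hp_time_slice _ _ _ p r a) => // q [].
Qed.

(* With N = m + 1, the points of the slab within (r/N)^2 of the extreme times
   are covered by 2 N^n cubes of radius 2r/N, of total measure O(r^(n+1)/N);
   ADR leaves room for other points. *)
Lemma exists_time_interior p r m : S p -> slab S p -> 0 < r -> (r%:E < diamp S)%E ->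
  (0 < m)%N -> 2 ^+ (2 * n + 3) * M ^+ 2 < m.+1%:R ->
  exists q, [/\ S q, cube (r / 2) p q & cube (r / m.+1%:R) q `<=` slab S].
Proof.
move=> Sp sp r0 rS m0 mM; apply: contrapT => /forallNP noq.
set h := r / m.+1%:R; have h0 : 0 < h by rewrite divr_gt0.
have r20 : 0 < r / 2 by rewrite divr_gt0.
pose a (b : bool) := fine (if b then T1 S else T0 S).
have near q : Delta S p (r / 2) q -> exists b, `|q.2 - a b| < h ^+ 2.
  move=> [Sq qp]; have : ~ (cube h q `<=` slab S) by move=> hq; apply: (noq q).
  by move=> /existsNP[y /not_implyP[qy /(not_slab_near Sq qy)]].
pose I : finType := (bool * {ffun 'I_n -> 'I_m.+1})%type.
pose B (i : I) : set (pt R n) := [set q | [/\ Delta S p (r / 2) q, slab S q,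
  `|q.2 - a i.1| < h ^+ 2 & grid m p.1 (r / 2) q.1 = i.2]].
(* [xget] picks a point of the cell, or [p] if the cell is empty; both lie in [S] and in the slab,
   so the ADR upper bound applies at either. *)
pose F (i : I) : set (borelT R n) := Delta S (xget p (B i)) (2 * h).
(* Points of [S] outside the slab sit at an extreme time; these slices are null. *)
pose G (b : bool) : set (borelT R n) := cube (r / 2) p `&` [set q | q.2 = a b].
have cover : Delta S p (r / 2) `<=` \big[setU/set0]_i F i `|` \big[setU/set0]_b G b.
  move=> q Dq; have [sq|/(not_slab_time Dq.1)[b qb]] := pselect (slab S q).
    left; have [b qb] := near q Dq; pose i : I := (b, grid m p.1 (r / 2) q.1).
    rewrite -bigcup_seq; exists i; first exact: mem_index_enum.
    have [[_ [wp _]] _ wb wg] : B i (xget p (B i)) by apply: xgetPex; exists q; split.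
    split; first exact: Dq.1.
    split=> [j|].
      have -> : 2 * h = 2 * (2 * (r / 2) / m.+1%:R) by rewrite /h; field; rewrite gt_eqF.
      have := @grid_close _ _ m p.1 (r / 2) q.1 (xget p (B i)).1 r20 (Dq.2.1) wp (esym wg) j.
      move/lt_trans; apply; rewrite ltr_pMl ?ltr1n// divr_gt0// mulr_gt0//.
    (* Both times are within [h ^+ 2] of the same [a b], hence less than
       [2 * h ^+ 2 <= (2 * h) ^+ 2] apart. *)
    by move: wb qb; rewrite /= !ltr_norml => /andP[? ?] /andP[? ?]; apply/andP; split; nra.
  right; rewrite -bigcup_seq.
  by exists b; [exact: mem_index_enum | split; first exact: Dq.2].
have mF i : measurable (F i) by exact: measurable_Delta.
have hS : ((2 * h)%:E < diamp S)%E.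
  apply: le_lt_trans rS; rewrite lee_fin /h mulrA ler_pdivrMr// mulrC ler_pM2l//.
  by rewrite ler_nat.
have muF i : (mu (F i) <= (M * (2 * h) ^+ n.+1)%:E)%E.
  have [Sw [w1 w2]] : S (xget p (B i)) /\ slab S (xget p (B i)).
    by case: xgetP => [w _ [[Sw _] sw _ _]|_].
  by apply: (adr Sw w1 w2 _ hS).2; rewrite mulr_gt0.
have mG b : measurable (G b) by exact: (mu_time_slice p (a b) r20).1.
have muG b : (mu (G b) <= 0)%E by rewrite (mu_time_slice p (a b) r20).2.
have mbF : measurable (\big[setU/set0]_i F i) by exact: bigsetU_measurable.
have mbG : measurable (\big[setU/set0]_b G b) by exact: bigsetU_measurable.
have up : (mu (Delta S p (r / 2)) <= (M * (2 * h) ^+ n.+1 *+ #|I|)%:E)%E.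
  apply: (@le_trans _ _ (mu (\big[setU/set0]_i F i `|` \big[setU/set0]_b G b))).
    apply: (le_measure mu _ _ cover); rewrite inE; first exact: measurable_Delta.
    exact: measurableU.
  apply: le_trans (measureU2 _ mbF mbG) _; rewrite -[leRHS]adde0; apply: leeD.
    by apply: le_trans (bigsetU_le mF muF) _; rewrite sumEFin sumr_const.
  by apply: le_trans (bigsetU_le mG muG) _; rewrite big1.
have r2S : ((r / 2)%:E < diamp S)%E by apply: le_lt_trans rS; rewrite lee_fin; lra.
have := le_trans (adr Sp sp.1 sp.2 r20 r2S).1 up; rewrite lee_fin.
rewrite /I card_prod card_bool card_ffun !card_ord -[leRHS]mulr_natl natrM natrX.
rewrite leNgt => /negP; apply; rewrite [ltRHS]mulrC ltr_pdivlMr//.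
have N0 : 0 < m.+1%:R :> R by rewrite ltr0n.
(* The cubes [F i] weigh at most [M * 2 ^+ (n + 2) * r ^+ n.+1 / m.+1%:R] in total, against the
   lower bound [M^-1 * (r / 2) ^+ n.+1]; hence the exponent [2 * n + 3]. *)
rewrite [ltLHS](_ : _ = r ^+ n.+1 * 2 ^- n.+1 * (2 ^+ (2 * n + 3) * M ^+ 2 / m.+1%:R)); last first.
  rewrite /h !exprMn exprVn mulnC exprD exprM !exprS; field.
  by rewrite !expf_neq0 ?gt_eqF.
rewrite expr_div_n gtr_pMr; first by rewrite ltr_pdivrMr// mul1r.
by rewrite divr_gt0// exprn_gt0.
Qed.

(** Otherwise [beta >= eps] at all these points and scales, so the Carleson integral is at least
    [K * eps ^+ 2 / 2] times the measure of [Delta S q rho]. By ADR and the choice of [K] this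
    exceeds [Mt * rho ^+ n.+1]. *)
Lemma exists_small_beta q rho eps K Mt : pUR mu S M Mt -> S q -> slab S q -> 0 < rho ->
  (rho%:E < diamp S)%E -> 0 < eps -> 2 * M * Mt / eps ^+ 2 < K%:R ->
  exists z s, [/\ S z, cube rho q z, rho / 2 ^+ K < s < rho & (beta mu S z s < eps%:E)%E].
Proof.
move=> ur Sq sq rho0 rhoS eps0 KM; apply: contrapT => H.
have hb z s : Delta S q rho z -> rho / 2 ^+ K < s < rho -> (eps%:E <= beta mu S z s)%E.
  move=> [Sz zq] hs; rewrite leNgt; apply/negP => hlt; apply: H; by exists z, s.
have b0 z s : (0 <= beta mu S z s)%E.
  by apply/ereal_infP => _ [P _ <-]; exact: sqrte_ge0.
have low : ((K%:R * eps ^+ 2 / 2)%:E * mu (Delta S q rho) <= nu_box mu S q rho)%E.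
  apply: ge0_integral_ge_cst => //.
  - exact: measurable_Delta.
  - by rewrite lee_fin divr_ge0// mulr_ge0// exprn_ge0// ltW.
  - move=> z _; apply: integral_ge0 => s; rewrite /Defs.open0/= in_itv/= => /andP[s0 _].
    by rewrite !mule_ge0// lee_fin invr_ge0 ltW.
  move=> z Dz; apply: ge0_integral_log => //.
  - by rewrite exprn_ge0// ltW.
  - by move=> s /andP[s0 _]; rewrite !mule_ge0// lee_fin invr_ge0 ltW.
  move=> s hs; have s0 : 0 < s.
    by case/andP: hs => h _; apply: le_lt_trans h; rewrite divr_ge0// ?exprn_ge0// ltW.
  rewrite expr2 2!EFinM; apply: lee_wpmul2r; first by rewrite lee_fin invr_ge0 ltW.
  by apply: lee_pmul; rewrite ?lee_fin ?(ltW eps0)//; exact: hb.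
have := le_trans low (ur.2 q Sq rho rho0).
have e0 : 0 <= K%:R * eps ^+ 2 / 2 by rewrite divr_ge0// mulr_ge0// exprn_ge0// ltW.
move/(le_trans (lee_wpmul2l _ (adr Sq sq.1 sq.2 rho0 rhoS).1)); rewrite lee_fin => /(_ e0).
rewrite -EFinM lee_fin mulrA ler_pM2r ?exprn_gt0//.
rewrite leNgt => /negP; apply.
rewrite ltr_pdivlMr// ltr_pdivlMr//; move: KM; rewrite ltr_pdivrMr ?exprn_gt0//; lra.
Qed.

(** Take a plane nearly optimal for [beta]. A point [y] of [S] violating the bound would make the
    distance to the plane at least [d * s / 2] on [Delta S y (d * s / 2)], whose measure ADR bounds
    below; that set alone brings the integral up to the threshold. *)
Lemma flat_of_small_beta z s d : S z -> 0 < s -> (s%:E < diamp S)%E -> 0 < d -> d <= 1 ->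
  cube s z `<=` slab S ->
  (beta mu S z s < (Num.sqrt ((d / 2) ^+ (n + 3) / M))%:E)%E ->
  exists u c, u != 0 /\ forall y, S y -> cube (s / 2) z y -> `|aff u c y.1| <= d * s.
Proof.
move=> Sz s0 sS d0 d1 zslab /ereal_inf_lt[_ [_ [u [c [u0 ->]]] <-] hlt].
exists u, c; split=> // y Sy yz; rewrite leNgt; apply/negP => hy.
move: hlt; rewrite ltNge => /negP; apply.
rewrite -[leLHS]/(sqrte ((d / 2) ^+ (n + 3) / M)%:E).
have i0 y' : (0 <= ((distp y' (vplane u c) / s) ^+ 2)%:E)%E by rewrite lee_fin sqr_ge0.
rewrite lee_sqrt; last first.
  rewrite mule_ge0// ?lee_fin ?invr_ge0 ?exprn_ge0 ?(ltW s0)//.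
  by apply: integral_ge0 => y' _; exact: i0.
have ds0 : 0 < d * s / 2 by rewrite divr_gt0// mulr_gt0.
have ds1 : d * s / 2 <= s / 2 by rewrite ler_pM2r// ler_piMl// ltW.
have yz' : cube (d * s / 2) y `<=` cube s z.
  apply: cube_sub yz _; [lra|exact: ltW|lra].
have sy : slab S y by apply/zslab/yz'; exact: cube_center.
have dS : ((d * s / 2)%:E < diamp S)%E by apply: le_lt_trans sS; rewrite lee_fin; lra.
have low : (((d / 2) ^+ 2)%:E * mu (Delta S y (d * s / 2)) <=
    \int[mu]_(y' in (Delta S z s : set (borelT R n))) ((distp y' (vplane u c) / s) ^+ 2)%:E)%E.
  apply: ge0_integral_ge_cst => //.
  - exact: measurable_Delta.
  - by move=> y' [Sy' /yz' y'z]; split.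
  - by rewrite lee_fin sqr_ge0.
  move=> y' [_ [y'y _]].
  have dist0 : 0 <= distp y' (vplane u c) := le_trans (normr_ge0 _) (aff_le_distp c y' u0).
  rewrite lee_fin lerXn2r ?nnegrE ?divr_ge0 ?(ltW s0) ?(ltW d0)//.
  rewrite ler_pdivlMr//; apply: le_trans (aff_le_distp c y' u0).
  have : `|aff u c y.1 - aff u c y'.1| <= d * s / 2.
    by apply: aff_lip => // i; rewrite distrC ltW.
  have := lerB_dist (aff u c y.1) (aff u c y'.1); lra.
have M1 := lee_wpmul2l _ (adr Sy sy.1 sy.2 ds0 dS).1.
have := le_trans (M1 ((d / 2) ^+ 2)%:E _) low; rewrite lee_fin sqr_ge0 => /(_ isT) low'.
have sn : (0 <= (s ^- n.+1)%:E)%E by rewrite lee_fin invr_ge0 exprn_ge0// ltW.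
apply: le_trans (lee_wpmul2l sn low'); rewrite -!EFinM lee_fin.
(* The threshold makes this an equality: [(d / 2) ^+ 2] comes from the integrand, [(d / 2) ^+ n.+1]
   from the radius [d * s / 2], and the powers of [s] cancel. *)
rewrite le_eqVlt; apply/orP; left; apply/eqP.
rewrite (_ : d * s / 2 = d / 2 * s); last by field.
rewrite (_ : (n + 3)%N = (2 + n.+1)%N); last by rewrite addnC add2n.
have : s ^+ n.+1 != 0 by rewrite expf_neq0// gt_eqF.
rewrite exprD [(d / 2 * s) ^+ _]exprMn; move: (s ^+ n.+1) ((d / 2) ^+ n.+1) => a b a0.
by field; rewrite a0 gt_eqF.
Qed.

(** Shifting the centre by [rho / 2] away from the plane leaves a cube of radius [rho / 4] on which
    [aff] has a fixed sign and modulus at least [rho / 4 > d * s]. Segments to its points from the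
    shifted centre at the old time then avoid [S]. *)
Lemma sync_cube z s d rho x p u c : u != 0 ->
  (forall y, S y -> cube (s / 2) z y -> `|aff u c y.1| <= d * s) ->
  0 < rho -> rho < s / 2 -> d * s < rho / 4 ->
  cube rho p `<=` cube (s / 2) z -> cube rho p `<=` connected_component (~` S) x ->
  exists p', [/\ p'.2 = z.2, cube (rho / 4) p' `<=` cube (s / 2) z &
    cube (rho / 4) p' `<=` connected_component (~` S) x].
Proof.
move=> u0 flat rho0 rhos dsrho pz px.
(* [e] records the side of the plane on which [p] lies, and [A] is moved further to that side. *)
pose e : R := if 0 <= aff u c p.1 then 1 else -1.
have e1 : `|e| = 1 by rewrite /e; case: ifP; rewrite ?normrN normr1.
pose A := p.1 + (e * (rho / 2)) *: sgrow u.
have sgA i : `|A 0 i - p.1 0 i| <= rho / 2.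
  rewrite !mxE addrC addKr 2!normrM e1 mul1r (gtr0_norm (_ : 0 < rho / 2)); last lra.
  by rewrite ler_piMr ?normr_sg ?lern1 ?leq_b1//; lra.
have fA : rho / 2 <= e * aff u c A.
  rewrite /A aff_shift// /e; case: ifPn; rewrite -?ltNge; lra.
have near (y : pt R n) (i : 'I_n) : cube (rho / 4) (A, z.2) y -> `|y.1 0 i - p.1 0 i| < rho.
  move=> [/(_ i)/= yA _]; have := sgA i; move: yA.
  by rewrite ltr_norml !ler_norml ltr_norml => /andP[? ?] /andP[? ?]; apply/andP; split; lra.
have sub : cube (rho / 4) (A, z.2) `<=` cube (s / 2) z.
  move=> y yA; split=> [i|].
    (* The spatial bounds are read off at the time of [p], where [pz] applies; the time bound is
       separate, the new cube being centred at time [z.2]. *)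
    have [h _] : cube (s / 2) z (y.1, p.2).
      by apply: pz; split=> [j|]/=; [exact: near|rewrite subrr normr0 exprn_gt0].
    exact: h.
  case: yA => _ /=/lt_le_trans; apply; rewrite lerXn2r ?nnegrE//; lra.
exists (A, z.2); split=> // y yA.
have pA : cube rho p (A, p.2).
  split=> [i|]/=; last by rewrite subrr normr0 exprn_gt0.
  by apply: le_lt_trans (sgA i) _; lra.
apply: (@seg_component _ _ _ (A, p.2)); last exact: px.
(* A point of [S] on the segment would obey [flat], but [e * aff] is at least [rho / 4] at both ends
   and affine in between. *)
move=> t t01 St; have := flat _ St (cube_convex (pz _ pA) (sub _ yA) t01).
rewrite /seg aff_segment/=; apply/negP; rewrite -ltNge; apply: lt_le_trans dsrho _.
have fy : rho / 4 <= e * aff u c y.1.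
  have : `|e * (aff u c y.1 - aff u c A)| <= rho / 4.
    by rewrite normrM e1 mul1r; apply: aff_lip => // i; apply: ltW; exact: yA.1.
  by rewrite mulrBr ler_norml => /andP[? ?]; lra.
have eX w : e * w <= `|w| by rewrite (le_trans (ler_norm _))// normrM e1 mul1r.
apply: le_trans (eX _); move: (aff u c A) (aff u c y.1) fA fy => a b ra rb.
case/andP: t01 => t0 t1; have h1 : 0 <= (1 - t) * (e * a - rho / 4) by rewrite mulr_ge0//; lra.
have h2 : 0 <= t * (e * b - rho / 4) by rewrite mulr_ge0//; lra.
lra.
Qed.

End TwoCube.


(** * Choice of the constants and conclusion *)

Theorem theorem3p2 (R : realType) (n : nat) (n_ge1 : (1 <= n)%N)
  (M Mt g0 : R) (M_gt0 : 0 < M) (Mt_gt0 : 0 < Mt) (g0_gt0 : 0 < g0) (g0_lt1 : g0 < 1) :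
  exists g1 : R, 0 < g1 /\ g1 < 1 /\
  forall (S : set (pt R n)) (mu : {measure set (borelT R n) -> \bar R}),
    closed S ->
    (forall A : set (borelT R n), measurable A -> mu A = Hp (n.+1) (A `&` S)) ->
    pADR mu S M ->
    corkscrew S g0 ->
    pUR mu S M Mt ->
    weak_ts_two_cube S g1.
Proof.
(* Corkscrew cubes at radius [s / 2] have [rho >= g0 * s / 2], so this [d] gives [d * s < rho / 4];
   [eps] is the matching flatness threshold. *)
pose d := g0 / 16; pose eps := Num.sqrt ((d / 2) ^+ (n + 3) / M).
have d0 : 0 < d by rewrite divr_gt0.
have d1 : d <= 1 by rewrite /d; lra.
have eps0 : 0 < eps by rewrite sqrtr_gt0 divr_gt0// exprn_gt0// divr_gt0.
pose m := (Num.trunc (2 ^+ (2 * n + 3) * M ^+ 2)).+1.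
have mM : 2 ^+ (2 * n + 3) * M ^+ 2 < m.+1%:R.
  by apply: lt_trans (truncnS_gt _) _; rewrite ltr_nat.
pose K := (Num.trunc (2 * M * Mt / eps ^+ 2)).+1.
have KM : 2 * M * Mt / eps ^+ 2 < K%:R by exact: truncnS_gt.
have N0 : 0 < m.+1%:R :> R by rewrite ltr0n.
have N2 : 2 <= m.+1%:R :> R by rewrite ler_nat.
have K0 : 1 <= 2 ^+ K :> R by rewrite exprn_ege1// ler1n.
(* Losses of scale: [m.+1] from [r] to [h], [2 * 2 ^+ K] from [h] to [s], [2] for the radius
   [s / 2], and [4] from [rho] to [rho / 4]. *)
pose D : R := 16 * m.+1%:R * 2 ^+ K.
have D1 : 1 < D by rewrite /D; nra.
have D0 : 0 < D by apply: lt_trans D1.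
exists (g0 / D); split; first by rewrite divr_gt0.
split; first by rewrite ltr_pdivrMr// mul1r; lra.
move=> S mu cS muHp adr cork ur p Sp p0 p1 r r0 rS.
have [q [Sq pq qslab]] :=
  exists_time_interior (m := m) M_gt0 cS muHp adr Sp (conj p0 p1) r0 rS isT mM.
pose h := r / m.+1%:R; have h0 : 0 < h by rewrite divr_gt0.
have hr : h <= r / 2 by rewrite ler_pM2l// lef_pV2 ?posrE.
have sq : slab S q by apply: qslab; exact: cube_center.
have rho0 : 0 < h / 2 by rewrite divr_gt0.
have rhoS : ((h / 2)%:E < diamp S)%E by apply: le_lt_trans rS; rewrite lee_fin; lra.
(* Starting from [h / 2] keeps [cube s z] inside [cube h q], hence inside the slab. *)
have [z [s [Sz qz /andP[ls us] bz]]] := exists_small_beta M_gt0 cS adr ur Sq sq rho0 rhoS eps0 KM.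
have s0 : 0 < s by apply: le_lt_trans ls; rewrite divr_ge0// ltW// exprn_gt0.
have sS : (s%:E < diamp S)%E by apply: lt_trans rhoS; rewrite lte_fin.
have zq : cube s z `<=` cube h q by apply: cube_sub qz _; lra.
have zslab : cube s z `<=` slab S by move=> y /zq; exact: qslab.
have [z0 z1] : slab S z by apply: zslab; exact: cube_center.
have [u [c [u0 flat]]] := flat_of_small_beta M_gt0 cS adr Sz s0 sS d0 d1 zslab bz.
have s20 : 0 < s / 2 by rewrite divr_gt0.
have s2S : ((s / 2)%:E < diamp S)%E by apply: lt_trans sS; rewrite lte_fin; lra.
have [rho [p1' [p2' [grho [rhos [c1 [c2 [x1 [x2 [nx1 [nx2 [d1' [d2' dx]]]]]]]]]]]]] :=
  cork z Sz z0 z1 (s / 2) s20 s2S.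
have rhop : 0 < rho by apply: lt_le_trans grho; rewrite mulr_gt0.
have z2s : cube (s / 2) z `<=` cube s z.
  by apply: cube_sub (cube_center z s20) _; lra.
(* The corkscrew cubes lie in the slab, so intersecting them with it changes nothing. *)
have comp x p' : cube rho p' `<=` cube (s / 2) z ->
    cube rho p' `&` slab S `<=` connected_component (~` S) x ->
    cube rho p' `<=` connected_component (~` S) x.
  by move=> cz px y yp; apply: px; split=> //; apply/zslab/z2s/cz.
have dsrho : d * s < rho / 4.
  apply: (@lt_le_trans _ _ (g0 * (s / 2) / 4)); rewrite ?ler_pM2r// /d.
  by have := mulr_gt0 g0_gt0 s0; lra.
have [b1 [t1 i1 j1]] := sync_cube u0 flat rhop rhos dsrho c1 (comp _ _ c1 d1').
have [b2 [t2 i2 j2]] := sync_cube u0 flat rhop rhos dsrho c2 (comp _ _ c2 d2').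
have zr : cube (s / 2) z `<=` cube r p.
  by move=> y /z2s/zq; apply: cube_sub pq _ y; lra.
exists (rho / 4), b1, b2; split.
  apply: (@le_trans _ _ (g0 * (s / 2) / 4)); last by rewrite ler_pM2r.
  apply: (@le_trans _ _ (g0 * (h / 2 / 2 ^+ K / 2) / 4)); last first.
    by rewrite ler_pM2r// ler_pM2l// ler_pM2r// ltW.
  rewrite le_eqVlt; apply/orP; left; apply/eqP; rewrite /D /h; field.
  by rewrite !gt_eqF// exprn_gt0.
split; first by lra.
split; first by move=> y /i1/zr.
split; first by move=> y /i2/zr.
split; first by rewrite t1 t2.
exists x1, x2; split=> //; split=> //.
by split; [move=> y [/j1]|split=> //; move=> y [/j2]].
Qed.
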